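(* Let $N\ge 3$. If $\mathcal{X}\in\mathbb{R}^{I_1\times I_2\times\cdots\times I_N}$ is a nonzero tensor with $\mathrm{MtpRank}(\mathcal{X})=(r_1,r_2,\dots,r_N)$, then $\mathrm{GTriRank}(\mathcal{X})=\max\{r_1,r_2,\dots,r_N\}$.
   Context: Multiple product: for positive integers $r_1,\dots,r_N$ and $N$-order real tensors $\mathcal{A}_n$ of size $r_1\times\cdots\times r_{n-1}\times I_n\times r_{n+1}\times\cdots\times r_N$ ($n=1,\dots,N$), the tensor $[\mathcal{A}_1\mathcal{A}_2\cdots\mathcal{A}_N]\in\mathbb{R}^{I_1\times\cdots\times I_N}$ is defined by $$[\mathcal{A}_1\cdots\mathcal{A}_N]_{i_1\dots i_N}=\sum_{p_1=1}^{r_1}\cdots\sum_{p_N=1}^{r_N}(\mathcal{A}_1)_{i_1p_2\dots p_N}(\mathcal{A}_2)_{p_1i_2p_3\dots p_N}\cdots(\mathcal{A}_N)_{p_1\dots p_{N-1}i_N},$$ where $\mathcal{A}_n$ carries $i_n$ in position $n$ and $p_m$ in each position $m\neq n$. A vector $(r_1,\dots,r_N)$ of positive integers is called admissible for $\mathcal{X}\in\mathbb{R}^{I_1\times\cdots\times I_N}$ if $\mathcal{X}=[\mathcal{A}_1\cdots\mathcal{A}_N]$ for some real factor tensors $\mathcal{A}_n\in\mathbb{R}^{r_1\times\cdots\times r_{n-1}\times I_n\times r_{n+1}\times\cdots\times r_N}$, $n=1,\dots,N$. $\mathrm{GTriRank}(\mathcal{X})$ (generalized triple rank), for nonzero $\mathcal{X}$,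 is the smallest positive integer $r$ such that $(r,r,\dots,r)$ is admissible for $\mathcal{X}$ (such $r$ always exists when $N\geq 3$). $\mathrm{MtpRank}(\mathcal{X})$ (Multiple rank), for nonzero $\mathcal{X}$, is the vector $\mathbf{r}=(r_1,\dots,r_N)$ that is admissible, satisfies $r_i\le\mathrm{GTriRank}(\mathcal{X})$ for all $i$, and has the smallest $\ell_1$ norm $r_1+\cdots+r_N$ among all such vectors; among several vectors with the same minimal $\ell_1$ norm, the lexicographically smallest one is taken. *)

(* Defs.v *)
From mathcomp Require Import all_boot all_order all_algebra.
From mathcomp Require Import boolp classical_sets reals.

Set Implicit Arguments.
Unset Strict Implicit.
Unset Printing Implicit Defensive.

Import Order.TTheory GRing.Theory.
Local Open Scope ring_scope.

(* Modes and indices are numbered from 0, so 'I_N stands for {1, ..., N} and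
   'I_(d n) for {1, ..., d_n}. *)
Notation mindex d := {dffun forall n, 'I_(d n)}.
Notation tensor R d := {ffun mindex d -> R}.

Definition factor_dims (N : nat) (d r : 'I_N -> nat) (n : 'I_N) : 'I_N -> nat :=
  fun m => if m == n then d m else r m.

(* (p_1, ..., p_(n-1), i_n, p_(n+1), ..., p_N) *)
Definition factor_index (N : nat) (d r : 'I_N -> nat) (n : 'I_N)
    (i : mindex d) (p : mindex r) : mindex (factor_dims d r n) :=
  [ffun m : 'I_N =>
     (if m == n as b return 'I_(if b then d m else r m) then i m else p m)].

Definition multiple_product (R : realType) (N : nat) (d r : 'I_N -> nat)
    (A : forall n : 'I_N, tensor R (factor_dims d r n)) : tensor R d :=
  [ffun i : mindex d =>
     \sum_(p : mindex r) \prod_(n < N) A n (factor_index n i p)].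

Definition admissible (R : realType) (N : nat) (d : 'I_N -> nat)
    (X : tensor R d) (r : N.-tuple nat) : Prop :=
  (forall n : 'I_N, (0 < tnth r n)%N) /\
  exists A : forall n : 'I_N, tensor R (factor_dims d (tnth r) n),
    X = multiple_product A.

Definition is_GTriRank (R : realType) (N : nat) (d : 'I_N -> nat)
    (X : tensor R d) (g : nat) : Prop :=
  [/\ (0 < g)%N, admissible X [tuple of nseq N g] &
      forall h : nat, (0 < h)%N -> admissible X [tuple of nseq N h] -> (g <= h)%N].

(* The default value is irrelevant for nonzero tensors of order at least 3: see
   GTriRankP. *)
Definition GTriRank (R : realType) (N : nat) (d : 'I_N -> nat)
    (X : tensor R d) : nat :=
  xget 0%N [set g | is_GTriRank X g]%classic.

Definition mtp_candidate (R : realType) (N : nat) (d : 'I_N -> nat)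
    (X : tensor R d) (r : N.-tuple nat) : Prop :=
  admissible X r /\ forall n : 'I_N, (tnth r n <= GTriRank X)%N.

Definition norm1 (N : nat) (r : N.-tuple nat) : nat := (\sum_(n < N) tnth r n)%N.

Definition is_MtpRank (R : realType) (N : nat) (d : 'I_N -> nat)
    (X : tensor R d) (r : N.-tuple nat) : Prop :=
  [/\ mtp_candidate X r,
      forall s : N.-tuple nat, mtp_candidate X s -> (norm1 r <= norm1 s)%N &
      forall s : N.-tuple nat, mtp_candidate X s -> norm1 s = norm1 r ->
        ((r : N.-tuplelexi nat) <= (s : N.-tuplelexi nat))%O].

(* The default value is irrelevant for nonzero tensors of order at least 3: see
   MtpRankP and MtpRank_unique. *)
Definition MtpRank (R : realType) (N : nat) (d : 'I_N -> nat)
    (X : tensor R d) : N.-tuple nat :=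
  xget [tuple of nseq N 0%N] [set r | is_MtpRank X r]%classic.

Lemma factor_indexE (N : nat) (d r : 'I_N -> nat) (n : 'I_N)
    (i : mindex d) (p : mindex r) (m : 'I_N) :
  factor_index n i p m = (if m == n then nat_of_ord (i m) else nat_of_ord (p m)) :> nat.
Proof. by rewrite ffunE /factor_dims; case: (m == n). Qed.

(* With g = max d_n, the factor at 0 carries the entries of X read through a
   permutation s fixing only 0, and the factor at n <> 0 forces p_(s n) = i_n and
   p_0 = 0; order at least 3 gives s n <> n for every n <> 0. *)
Lemma GTriRank_exists (R : realType) (N : nat) (d : 'I_N -> nat)
    (X : tensor R d) :
  (2 < N)%N -> X != 0 -> exists2 g, (0 < g)%N & admissible X [tuple of nseq N g].
Proof.
move=> N3 X0.
have [i0 _] : exists i : mindex d, X i != 0.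
  apply/existsP; apply: contraNT X0 => /existsPn H.
  by apply/eqP/ffunP => i; rewrite ffunE; apply/eqP; move: (H i); rewrite negbK.
case: N N3 => [//|N] N1 in d X X0 i0 *; rewrite ltnS in N1.
pose g := (\max_(n < N.+1) d n)%N.
have dg n : (d n <= g)%N by exact: leq_bigmax.
have g0 : (0 < g)%N by apply: leq_trans (dg ord0); exact: leq_ltn_trans (ltn_ord (i0 ord0)).
exists g => //; split=> [n|]; first by rewrite tnth_nseq.
pose r := tnth [tuple of nseq N.+1 g].
have rE n : r n = g by rewrite /r tnth_nseq.
pose sn (n : nat) := (if n == 0 then 0 else if n == N then 1 else n.+1)%N.
pose tn (n : nat) := (if n == 0 then 0 else if n == 1 then N else n.-1)%N.
have snN (n : 'I_N.+1) : (sn n < N.+1)%N.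
  rewrite /sn; case: (altP eqP) => // _; case: (altP eqP) => [_|nN]; first by rewrite ltnS ltnW.
  by rewrite ltnS ltn_neqAle nN -ltnS /=.
have tnN (n : 'I_N.+1) : (tn n < N.+1)%N.
  rewrite /tn; case: (altP eqP) => // _; case: (altP eqP) => [_|_] //.
  by apply: leq_ltn_trans (ltn_ord n); exact: leq_pred.
pose s n := Ordinal (snN n); pose t n := Ordinal (tnN n).
have s_neq n : n != ord0 -> s n != n.
  case: n => [[|n] ln] // _; rewrite -val_eqE /= /sn /=.
  by case: (n.+1 =P N) => [->|_]; rewrite neq_ltn ?N1 // ltnSn orbT.
have sK : cancel s t.
  move=> [[|n] ln]; apply: val_inj; rewrite /= /tn /sn //=.
  by case: (n.+1 =P N) => [->|].
have tK : cancel t s.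
  move=> [[|[|n]] ln]; apply: val_inj; rewrite /= /tn /sn //=.
    by rewrite eqxx -(subnKC N1).
  by rewrite ltn_eqF.
have s0 : s ord0 = ord0 by exact: val_inj.
pose dec (q : 'I_N.+1 -> nat) : mindex d :=
  [ffun n : 'I_N.+1 => insubd (i0 n) (q n)].
pose A n : tensor R (factor_dims d r n) := 
  [ffun q : mindex (factor_dims d r n) =>
    if n == ord0 then X (dec (fun m => nat_of_ord (q (s m))))
    else ((nat_of_ord (q (s n)) == nat_of_ord (q n))
          && (nat_of_ord (q ord0) == 0%N))%:R].
exists A; apply/ffunP => i; rewrite ffunE.
have pg (n : 'I_N.+1) : ((if n == ord0 then 0 else i (t n)) < r n)%N.
  rewrite rE; case: eqP => // _; exact: leq_trans (ltn_ord _) (dg _).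
pose p : mindex r := [ffun n : 'I_N.+1 => Ordinal (pg n)].
have An n (q : mindex r) : n != ord0 -> A n (factor_index n i q) =
    ((nat_of_ord (q (s n)) == nat_of_ord (i n)) && (nat_of_ord (q ord0) == 0%N))%:R.
  move=> n0; rewrite ffunE (negbTE n0) !factor_indexE eqxx.
  by rewrite (negbTE (s_neq _ n0)) eq_sym -[ord0 == n]eq_sym (negbTE n0) eq_sym.
rewrite (bigD1 p) //= [X in _ + X]big1 ?addr0; last first.
  move=> q qp; have [n n0 An0] : exists2 n, n != ord0 & A n (factor_index n i q) = 0.
    apply: contrapT => H; case/eqP: qp; apply/ffunP => n; apply: val_inj.
    rewrite ffunE /=.
    have Hn m : m != ord0 -> (nat_of_ord (q (s m)) == nat_of_ord (i m)) && (nat_of_ord (q ord0) == 0%N).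
      by move=> m0; apply: contrapT => /negP/negbTE H'; apply: H; exists m; rewrite // An // H'.
    case: (altP eqP) => [->|n0].
      have m0 : (ord_max : 'I_N.+1) != ord0 by rewrite -val_eqE /= -(subnKC N1).
      by have /andP[_ /eqP] := Hn _ m0.
    have /Hn/andP[/eqP] : t n != ord0 by rewrite -(inj_eq (can_inj sK)) tK s0.
    by rewrite tK.
  by rewrite (bigD1 n) //= An0 mul0r.
rewrite (bigD1 ord0) //= [X in _ * X]big1 => [|n n0]; last first.
  rewrite An // !ffunE /= eqxx andbT sK -s0.
  by rewrite (inj_eq (can_inj sK)) (negbTE n0) eqxx.
rewrite mulr1 ffunE eqxx; congr (X _); apply/ffunP => n; apply: val_inj.
rewrite ffunE factor_indexE -{1}s0 (inj_eq (can_inj sK)).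
case: (altP eqP) => [->|n0]; first by rewrite s0 valKd.
by rewrite ffunE /= -s0 (inj_eq (can_inj sK)) (negbTE n0) sK valKd.
Qed.

Lemma GTriRankP (R : realType) (N : nat) (d : 'I_N -> nat) (X : tensor R d) :
  (2 < N)%N -> X != 0 -> is_GTriRank X (GTriRank X).
Proof.
move=> N3 X0; apply: (xgetPex 0%N (P := [set g | is_GTriRank X g]%classic)).
have ex : exists g, (0 < g)%N && `[< admissible X [tuple of nseq N g] >].
  by have [g g0 Hg] := GTriRank_exists N3 X0; exists g; rewrite g0; apply/asboolP.
case: (ex_minnP ex) => g /andP[g0 /asboolP Hg] gmin; exists g; split=> // h h0 Hh.
by apply: gmin; rewrite h0; apply/asboolP.
Qed.

Lemma MtpRankP (R : realType) (N : nat) (d : 'I_N -> nat) (X : tensor R d) :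
  (2 < N)%N -> X != 0 -> is_MtpRank X (MtpRank X).
Proof.
move=> N3 X0; apply: (xgetPex _ (P := [set r | is_MtpRank X r]%classic)).
have [_ Hg _] := GTriRankP N3 X0.
have exn : exists k, `[< exists2 s, mtp_candidate X s & norm1 s = k >].
  exists (norm1 [tuple of nseq N (GTriRank X)]); apply/asboolP.
  by exists [tuple of nseq N (GTriRank X)] => //; split=> // n; rewrite tnth_nseq.
case: (ex_minnP exn) => k /asboolP[s Xs sk] kmin.
pose f (u : N.-tuple 'I_(GTriRank X).+1) : N.-tuplelexi nat :=
  map_tuple (@nat_of_ord _) u.
have fP v : mtp_candidate X v -> exists u, f u = v.
  move=> [_ vg]; exists (map_tuple (@inord (GTriRank X)) v).
  by apply: eq_from_tnth => n; rewrite !tnth_map inordK // ltnS vg.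
pose P u := `[< mtp_candidate X (f u) /\ norm1 (f u) = k >].
have [u0 fu0] := fP _ Xs.
have Pu0 : P u0 by apply/asboolP; rewrite fu0.
case: (arg_minP f Pu0) => u /asboolP[Xu uk] umin.
exists (f u); split=> // [v Xv|v Xv vk].
  by rewrite uk; apply: kmin; apply/asboolP; exists v.
have [w fw] := fP _ Xv; rewrite -fw; apply: umin.
by apply/asboolP; rewrite fw; split; rewrite // vk.
Qed.

Lemma MtpRank_unique (R : realType) (N : nat) (d : 'I_N -> nat)
    (X : tensor R d) (r s : N.-tuple nat) :
  is_MtpRank X r -> is_MtpRank X s -> r = s.
Proof.
move=> [Xr rmin rlex] [Xs smin slex].
have rs : norm1 r = norm1 s by apply/eqP; rewrite eqn_leq rmin ?smin.
by apply: (@le_anti _ (N.-tuplelexi nat)); rewrite rlex ?slex.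
Qed.

(* Main.v *)
Require Import Defs.
From mathcomp Require Import all_boot all_order all_algebra.
From mathcomp Require Import boolp classical_sets reals.

(** Admissibility is monotone in the size vector when the order is at least 2:
    factors of sizes r can be padded with zeros to any larger sizes s
    ([multiple_product_pad]).  A summation index p that leaves the old range in
    some mode m kills every factor other than the m-th, and such a factor exists,
    so the padded product has exactly the old nonzero terms.

    Let g be the generalized triple rank of X, r its multiple rank and M the
    maximum of r.  Since r is a candidate for the multiple rank, M <= g.
    Conversely r is admissible and bounded by M entrywise, so (M, ..., M) is
    admissible by monotonicity, and g <= M by minimality of g. *)

Import GRing.Theory.
Local Open Scope ring_scope.

Definition widen_mindex (N : nat) (r s : 'I_N -> nat)
    (rs : forall n, (r n <= s n)%N) (p : mindex r) : mindex s :=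
  [ffun n : 'I_N => widen_ord (rs n) (p n)].
Arguments widen_mindex {N r s} rs p.

Lemma widen_mindex_inj (N : nat) (r s : 'I_N -> nat)
    (rs : forall n, (r n <= s n)%N) : injective (widen_mindex rs).
Proof.
move=> p q /ffunP pq; apply/ffunP => n; apply: val_inj.
by have := congr1 val (pq n); rewrite !ffunE.
Qed.

Lemma widen_mindex_image (N : nat) (r s : 'I_N -> nat)
    (rs : forall n, (r n <= s n)%N) (q : mindex s) :
  (forall n, (q n < r n)%N) -> q \in [set widen_mindex rs p | p : mindex r].
Proof.
move=> qr; apply/imsetP; exists [ffun n : 'I_N => Ordinal (qr n)] => //.
by apply/ffunP => n; apply: val_inj; rewrite !ffunE.
Qed.

(** Extension of a tensor by zero to a box of any dimensions.  The sum has at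
    most one term: it reads the entry of A at the index with the same values as q,
    and vanishes when there is none, with no default index to provide when the
    box of A is empty. *)
Definition zero_pad (R : realType) (N : nat) (d e : 'I_N -> nat)
    (A : tensor R d) : tensor R e :=
  [ffun q : mindex e =>
     \sum_(u : mindex d | [forall m, nat_of_ord (u m) == q m]) A u].
Arguments zero_pad {R N d} e A.

Lemma zero_pad_in (R : realType) (N : nat) (d e : 'I_N -> nat)
    (A : tensor R d) (u : mindex d) (q : mindex e) :
  (forall m, nat_of_ord (u m) = q m) -> zero_pad e A q = A u.
Proof.
move=> uq; rewrite ffunE (big_pred1 u) // => v; apply/forallP/eqP => [vq|-> m].
  by apply/ffunP => m; apply: val_inj; rewrite /= (eqP (vq m)).
by rewrite uq.
Qed.

Lemma zero_pad_out (R : realType) (N : nat) (d e : 'I_N -> nat)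
    (A : tensor R d) (q : mindex e) (m : 'I_N) :
  (d m <= q m)%N -> zero_pad e A q = 0.
Proof.
move=> dq; rewrite ffunE big_pred0 // => u; apply/forallP => /(_ m)/eqP uq.
by have := ltn_ord (u m); rewrite uq ltnNge dq.
Qed.

(** Order at least 2 matters: in order 1 the entries of the product are those
    of the only factor multiplied by the number of summation indices, which
    padding changes. *)
Lemma multiple_product_pad (R : realType) (N : nat) (d r s : 'I_N -> nat)
    (A : forall n : 'I_N, tensor R (factor_dims d r n)) :
  (1 < N)%N -> (forall n, (r n <= s n)%N) ->
  multiple_product (fun n => zero_pad (factor_dims d s n) (A n)) =
    multiple_product A.
Proof.
move=> N1 rs; apply/ffunP => i; rewrite !ffunE.
rewrite (bigID (mem [set widen_mindex rs p | p : mindex r])) /=.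
rewrite [X in _ + X]big1 ?addr0 => [|q /negP qr]; last first.
  have [m rq] : exists m, (r m <= q m)%N.
    apply: contrapT => /forallNP rq; apply: qr; apply: widen_mindex_image => n.
    by rewrite ltnNge; apply/negP; exact: rq.
  have [n nm] : exists n, n != m.
    have [->|m0] := eqVneq m (Ordinal (ltnW N1)); first by exists (Ordinal N1).
    by exists (Ordinal (ltnW N1)); rewrite eq_sym.
  rewrite (bigD1 n) //= (@zero_pad_out _ _ _ _ _ _ m) ?mul0r //.
  by rewrite factor_indexE /factor_dims eq_sym (negbTE nm).
rewrite big_imset /=; last by move=> p q _ _; exact: widen_mindex_inj.
apply: eq_big => // p _; apply: eq_bigr => n _; apply: zero_pad_in => m.
by rewrite !factor_indexE ffunE.
Qed.

Lemma admissible_le (R : realType) (N : nat) (d : 'I_N -> nat) (X : tensor R d)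
    (r s : N.-tuple nat) :
  (1 < N)%N -> (forall n, (tnth r n <= tnth s n)%N) ->
  admissible X r -> admissible X s.
Proof.
move=> N1 rs [r0 [A XA]]; split=> [n|]; first exact: leq_trans (r0 n) (rs n).
exists (fun n => zero_pad (factor_dims d (tnth s) n) (A n)).
by rewrite multiple_product_pad.
Qed.

Theorem theorem3p2 (R : realType) (N : nat) (d : 'I_N -> nat)
    (X : tensor R d) (r : N.-tuple nat) :
  (3 <= N)%N -> X != 0 -> MtpRank X = r ->
  GTriRank X = (\max_(n < N) tnth r n)%N.
Proof.
move=> N3 X0 Xr.
have [_ _ gmin] := GTriRankP N3 X0.
have [[rX rg] _ _] := MtpRankP N3 X0; rewrite Xr in rX rg.
have rM n : (tnth r n <= \max_(n < N) tnth r n)%N by exact: leq_bigmax.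
apply/eqP; rewrite eqn_leq; apply/andP; split; last by apply/bigmax_leqP.
apply: gmin.
  have [r0 _] := rX; pose n0 := Ordinal (ltnW (ltnW N3)).
  exact: leq_trans (r0 n0) (rM n0).
by apply: admissible_le rX => [|n]; [exact: ltnW | rewrite tnth_nseq].
Qed.
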